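(* Let $X\in\mathbb{R}^{n\times p}$ be deterministic with $\|X_j\|_2^2=n$ for all $j\in[p]$, let $\beta^*\in\mathbb{R}^p$ have support $S$ with $|S|=s$, let $\sigma>0$, and let $y=X\beta^*+\varepsilon$ with $\varepsilon\sim\mathcal{N}(0,\sigma^2I_n)$. Assume that $X$ satisfies the restricted eigenvalue condition RE($3$, $s$), and let $\lambda=5\sigma\sqrt{2\log(p/\delta)/n}$ for some $\delta\in(0,1)$. Let $\hat\beta=\hat\beta^{\lambda}$ be a Lasso solution with parameter $\lambda$ and let $\bar\beta$ be the Sign-Least-Squares Lasso solution associated with $\hat\beta$. Then with probability at least $1-\delta$, $$\frac1n\|X(\beta^*-\bar\beta)\|_2^2+\frac1n\|X(\beta^*-\hat\beta)\|_2^2\le\frac{\lambda^2s}{\kappa^2(1,s)}+\frac{9\lambda^2s}{4\kappa^2(3,s)} .$$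
   Context: $[p]=\{1,\dots,p\}$; $X_j$ is the $j$-th column of $X$; for $J\subset[p]$, $\Delta_J$ is the subvector of $\Delta$ indexed by $J$, $X_J$ the submatrix of $X$ with columns in $J$, and $J^c=[p]\setminus J$; $\odot$ is the entrywise product. A Lasso solution with parameter $\lambda>0$ is any $\hat\beta^{\lambda}\in\arg\min_{\beta\in\mathbb{R}^p}\frac{1}{2n}\|y-X\beta\|_2^2+\lambda\|\beta\|_1$. Put $\hat\rho^{\lambda}=\frac{1}{\lambda n}X^\top(y-X\hat\beta^{\lambda})$ and $E=\{j\in[p]:|\hat\rho^{\lambda}_j|=1\}$ (equicorrelation set). A Sign-Least-Squares Lasso solution associated with $\hat\beta^\lambda$ is any $\bar\beta\in\mathbb{R}^p$ with $\bar\beta_{E^c}=0$ and $\bar\beta_E\in\arg\min\{\frac1{2n}\|y-X_E\beta_E\|_2^2:\ \beta_E\in\mathbb{R}^{|E|},\ \hat\rho^{\lambda}_E\odot\beta_E\ge0\}$ (entrywise inequality). $X$ satisfies RE($c_0$, $s$), where $c_0>0$ and $s\in[p]$, if there is a constant $\kappa(c_0,s)>0$ such that for all $J\subset[p]$ with $|J|\le s$ and all $\Delta\in\mathbb{R}^p$ (nonzero on $J$), $\|\Delta_{J^c}\|_1\le c_0\|\Delta_J\|_1$ implies $\frac{\|X\Delta\|_2^2}{n\|\Delta_J\|_2^2}\ge\kappa^2(c_0,s)$. RE($3$, $s$) implies RE($1$, $s$); $\kappa(3,s)$ and $\kappa(1,s)$ denote such constants. *)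

(* Defs.v *)
From HB Require Import structures.
From mathcomp Require Import all_boot all_order all_algebra.
From mathcomp Require Import all_classical all_reals all_analysis.
Set Implicit Arguments.
Unset Strict Implicit.
Unset Printing Implicit Defensive.
Import Order.TTheory GRing.Theory Num.Theory.
Local Open Scope classical_set_scope.
Local Open Scope ring_scope.

Section LinearModel.
Variable R : realType.

(* The norm that the library puts on matrices is the sup norm, hence these. *)
Definition l1norm (m : nat) (v : 'cV[R]_m) : R := \sum_i `|v i 0|.
Definition l2norm (m : nat) (v : 'cV[R]_m) : R :=
  Num.sqrt (\sum_i v i 0 ^+ 2).

Definition supp (p : nat) (v : 'cV[R]_p) : {set 'I_p} :=
  [set j | v j 0 != 0]%SET.

(* R^|J| is 'cV_#|J|, its coordinates listing J in increasing order. *)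
Definition subvec (p : nat) (J : {set 'I_p}) (v : 'cV[R]_p) : 'cV[R]_#|J| :=
  rowsub (@enum_val _ (mem J)) v.
Definition subcols (n p : nat) (J : {set 'I_p}) (X : 'M[R]_(n, p)) :
    'M[R]_(n, #|J|) :=
  colsub (@enum_val _ (mem J)) X.

Definition lasso_objective (n p : nat) (X : 'M[R]_(n, p)) (y : 'cV[R]_n)
    (lambda : R) (b : 'cV[R]_p) : R :=
  (2 * n%:R)^-1 * l2norm (y - X *m b) ^+ 2 + lambda * l1norm b.

Definition lasso_solution (n p : nat) (X : 'M[R]_(n, p)) (y : 'cV[R]_n)
    (lambda : R) (bhat : 'cV[R]_p) : Prop :=
  forall b : 'cV[R]_p,
    lasso_objective X y lambda bhat <= lasso_objective X y lambda b.

Definition rho_hat (n p : nat) (X : 'M[R]_(n, p)) (y : 'cV[R]_n)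
    (lambda : R) (bhat : 'cV[R]_p) : 'cV[R]_p :=
  (lambda * n%:R)^-1 *: (X^T *m (y - X *m bhat)).

Definition equicorrelation (n p : nat) (X : 'M[R]_(n, p)) (y : 'cV[R]_n)
    (lambda : R) (bhat : 'cV[R]_p) : {set 'I_p} :=
  [set j | `|rho_hat X y lambda bhat j 0| == 1]%SET.

Definition ls_objective (n m : nat) (X : 'M[R]_(n, m)) (y : 'cV[R]_n)
    (b : 'cV[R]_m) : R :=
  (2 * n%:R)^-1 * l2norm (y - X *m b) ^+ 2.

Definition sign_feasible (m : nat) (rho b : 'cV[R]_m) : Prop :=
  forall k, 0 <= rho k 0 * b k 0.

Definition sign_ls_solution (n p : nat) (X : 'M[R]_(n, p)) (y : 'cV[R]_n)
    (lambda : R) (bhat bbar : 'cV[R]_p) : Prop :=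
  let E := equicorrelation X y lambda bhat in
  let rhoE := subvec E (rho_hat X y lambda bhat) in
  [/\ subvec (~: E)%SET bbar = 0,
      sign_feasible rhoE (subvec E bbar) &
      forall b : 'cV[R]_#|E|, sign_feasible rhoE b ->
        ls_objective (subcols E X) y (subvec E bbar) <=
        ls_objective (subcols E X) y b].

(* kappa is an admissible constant kappa(c0, s). *)
Definition RE_constant (n p : nat) (X : 'M[R]_(n, p)) (c0 : R) (s : nat)
    (kappa : R) : Prop :=
  0 < kappa /\
  forall (J : {set 'I_p}) (D : 'cV[R]_p),
    (#|J| <= s)%N -> subvec J D != 0 ->
    l1norm (subvec (~: J)%SET D) <= c0 * l1norm (subvec J D) ->
    kappa ^+ 2 <= l2norm (X *m D) ^+ 2 / (n%:R * l2norm (subvec J D) ^+ 2).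

Definition RE (n p : nat) (X : 'M[R]_(n, p)) (c0 : R) (s : nat) : Prop :=
  exists kappa : R, RE_constant X c0 s kappa.

Lemma RE_constant_le (n p : nat) (X : 'M[R]_(n, p)) (c0 c1 : R) (s : nat)
    (kappa : R) :
  c0 <= c1 -> RE_constant X c1 s kappa -> RE_constant X c0 s kappa.
Proof.
move=> c01 [k0 H]; split=> // J D Js D0 cone; apply: H => //.
by apply: le_trans cone _; rewrite ler_wpM2r // /l1norm sumr_ge0.
Qed.

Section Probability.
Context (d : measure_display) (T : measurableType d) (P : probability T R).

Definition mutually_independent (n : nat) (Z : 'I_n -> {RV P >-> R}) : Prop :=
  forall (J : {set 'I_n}) (A : 'I_n -> set R),
    (forall i, measurable (A i)) ->
    P (\bigcap_(i in [set` J]) (Z i @^-1` A i)) =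
    (\prod_(i in J) P (Z i @^-1` A i))%E.

(* The vector (Z_1, ..., Z_n) has the law N(0, sigma^2 I_n), sigma > 0; the
   second parameter of normal_prob is the standard deviation. *)
Definition gaussian_noise (n : nat) (sigma : R) (Z : 'I_n -> {RV P >-> R}) :
    Prop :=
  mutually_independent Z /\
  forall (i : 'I_n) (A : set R), measurable A ->
    distribution P (Z i) A = normal_prob 0 sigma A.

Definition random_vector (n : nat) (Z : 'I_n -> {RV P >-> R}) (w : T) :
    'cV[R]_n := \col_i Z i w.

(* B need not be measurable, so that solutions of a random minimization problem
   may be selected in an arbitrary way; for a measurable B this is q <= P B. *)
Definition with_probability_ge (q : R) (B : set T) : Prop :=
  exists A : set T, [/\ measurable A, A `<=` B & (q%:E <= P A)%E].

End Probability.
End LinearModel.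

(* Main.v *)
(**
Write u = X (beta - bbar), v = X (beta - bhat) and expand
|u|^2 + |v|^2 = 2 <u, v> + |u - v|^2. The optimality conditions of the two
convex problems, together with the fact that rho . bbar = |bbar|_1, bound this
by lambda n (2 |beta|_1 - |bbar|_1 - |bhat|_1) plus the noise term
2 <eps, X (bbar - beta)>. So all the noise is paid by bbar, which only needs the
cone constant 3 with slope 3/2, while bhat needs the cone constant 1 with
slope 1; outside its cone a term is nonpositive and can be dropped, and inside
AM-GM against the restricted eigenvalue bound absorbs half of the left-hand side.

The noise satisfies |X_j . eps| <= lambda n / 5 for all j with probability
1 - delta: X_j . eps is N(0, n sigma^2), and a union bound over p columns with
the two-sided tail P(|N(0, s^2)| > t) <= exp(- t^2 / (2 s^2)) suffices. No
factor 2 can be afforded there, so sub-Gaussianity is not enough and the law of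
X_j . eps is computed by convolution of densities.
*)
Require Import Defs.
From HB Require Import structures.
From mathcomp Require Import all_boot all_order all_algebra.
From mathcomp Require Import all_classical all_reals all_analysis.
From mathcomp Require Import measurable_realfun ring lra.
Set Implicit Arguments.
Unset Strict Implicit.
Unset Printing Implicit Defensive.
Import Order.TTheory GRing.Theory Num.Theory.
Local Open Scope classical_set_scope.
Local Open Scope ring_scope.

(** * Inner products and the l1 and l2 norms of coordinate vectors *)

Section Vectors.
Variable R : realType.

(** Stands in for differentiation: a first-order condition appears as [a <= t * c] once the
    optimality inequality at step [t] has been divided by [t], and letting [t] tend to 0 leaves
    [a <= 0]. *)
Lemma le0_of_le_mul (a c : R) :
  (forall t, 0 < t -> t <= 1 -> a <= t * c) -> a <= 0.
Proof.
move=> h; rewrite leNgt; apply/negP => a0.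
have c1 : 0 < `|c| + 1 by rewrite ltr_pwDr.
(* This choice gives t |c| <= a/2 < a; the added 1 keeps the denominator positive when [c] is 0. *)
pose t := Num.min 1 (a / (2 * (`|c| + 1))).
have t0 : 0 < t by rewrite lt_min ltr01 divr_gt0// mulr_gt0.
have /(h t t0) : t <= 1 by rewrite ge_min lexx.
apply/negP; rewrite -ltNge (le_lt_trans (ler_wpM2l (ltW t0) (ler_norm c)))//.
apply: (@le_lt_trans _ _ (a / (2 * (`|c| + 1)) * (`|c| + 1))).
  apply: ler_pM; [exact: ltW|exact: normr_ge0| |by rewrite lerDl].
  by rewrite ge_min lexx orbT.
rewrite invfM mulrA mulfVK ?gt_eqF//.
by rewrite ltr_pdivrMr// ltr_pMr// ltr1n.
Qed.

Definition dot (m : nat) (u v : 'cV[R]_m) : R := \sum_i u i 0 * v i 0.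

Lemma dotC m (u v : 'cV[R]_m) : dot u v = dot v u.
Proof. by apply: eq_bigr => i _; rewrite mulrC. Qed.

Lemma dotDl m (u v w : 'cV[R]_m) : dot (u + v) w = dot u w + dot v w.
Proof. by rewrite /dot -big_split; apply: eq_bigr => i _; rewrite mxE mulrDl. Qed.

Lemma dotZl m a (u v : 'cV[R]_m) : dot (a *: u) v = a * dot u v.
Proof. by rewrite /dot mulr_sumr; apply: eq_bigr => i _; rewrite mxE mulrA. Qed.

Lemma dotNl m (u v : 'cV[R]_m) : dot (- u) v = - dot u v.
Proof. by rewrite -scaleN1r dotZl mulN1r. Qed.

Lemma dotDr m (u v w : 'cV[R]_m) : dot u (v + w) = dot u v + dot u w.
Proof. by rewrite dotC dotDl !(dotC _ u). Qed.

Lemma dotZr m a (u v : 'cV[R]_m) : dot u (a *: v) = a * dot u v.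
Proof. by rewrite dotC dotZl dotC. Qed.

Lemma dotNr m (u v : 'cV[R]_m) : dot u (- v) = - dot u v.
Proof. by rewrite dotC dotNl dotC. Qed.

Definition dotE := (dotDl, dotDr, dotNl, dotNr, dotZl, dotZr).

Lemma dot_subZ m t (u v : 'cV[R]_m) :
  dot (u - t *: v) (u - t *: v) = dot u u - 2 * t * dot u v + t ^+ 2 * dot v v.
Proof. by rewrite !dotE (dotC v u); ring. Qed.

Lemma l2norm_sqr m (v : 'cV[R]_m) : l2norm v ^+ 2 = dot v v.
Proof.
rewrite /l2norm sqr_sqrtr; last by apply: sumr_ge0 => i _; exact: sqr_ge0.
by apply: eq_bigr => i _; rewrite expr2.
Qed.

Lemma dot_mulmxr n m (u : 'cV[R]_n) (A : 'M[R]_(n, m)) (b : 'cV[R]_m) :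
  dot u (A *m b) = dot (A^T *m u) b.
Proof.
rewrite /dot; under eq_bigr do rewrite mxE mulr_sumr.
rewrite exchange_big; apply: eq_bigr => j _; rewrite mxE mulr_suml.
by apply: eq_bigr => i _; rewrite mxE mulrCA mulrA.
Qed.

Lemma l1normD m (u v : 'cV[R]_m) : l1norm (u + v) <= l1norm u + l1norm v.
Proof.
by rewrite /l1norm -big_split; apply: ler_sum => i _; rewrite mxE ler_normD.
Qed.

Lemma l1normZ m a (u : 'cV[R]_m) : l1norm (a *: u) = `|a| * l1norm u.
Proof. by rewrite /l1norm mulr_sumr; apply: eq_bigr => i _; rewrite mxE normrM. Qed.

Lemma l1norm_ge0 m (u : 'cV[R]_m) : 0 <= l1norm u.
Proof. by rewrite sumr_ge0. Qed.

Lemma dot_le_l1norm m t (u v : 'cV[R]_m) :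
  (forall j, `|u j 0| <= t) -> dot u v <= t * l1norm v.
Proof.
move=> ut; rewrite /dot /l1norm mulr_sumr; apply: ler_sum => j _.
by apply: le_trans (ler_norm _) _; rewrite normrM ler_wpM2r.
Qed.

Lemma dot_delta m (u : 'cV[R]_m) j : dot u (delta_mx j 0) = u j 0.
Proof.
rewrite /dot (bigD1 j)//= big1 ?addr0 => [|i /negbTE ij].
  by rewrite mxE !eqxx mulr1.
by rewrite mxE ij mulr0.
Qed.

Lemma l1norm_delta m (j : 'I_m) : l1norm (delta_mx j 0 : 'cV[R]_m) = 1.
Proof.
rewrite /l1norm (bigD1 j)//= big1 ?addr0 => [|i /negbTE ij].
  by rewrite mxE !eqxx normr1.
by rewrite mxE ij normr0.
Qed.

Lemma subvecE p (J : {set 'I_p}) (v : 'cV[R]_p) k :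
  subvec J v k 0 = v (enum_val k) 0.
Proof. exact: mxE. Qed.

Lemma sum_subvec p (J : {set 'I_p}) (v : 'cV[R]_p) (f : R -> R) :
  \sum_k f (subvec J v k 0) = \sum_(j in J) f (v j 0).
Proof. by rewrite [RHS]big_enum_val; apply: eq_bigr => k _; rewrite mxE. Qed.

Lemma l1norm_subvec p (J : {set 'I_p}) (v : 'cV[R]_p) :
  l1norm (subvec J v) = \sum_(j in J) `|v j 0|.
Proof. exact: sum_subvec. Qed.

Lemma subvec_eq0 p (J : {set 'I_p}) (v : 'cV[R]_p) :
  subvec J v = 0 -> forall j, j \in J -> v j 0 = 0.
Proof.
move=> /colP v0 j jJ; have := v0 (enum_rank_in jJ j).
by rewrite !mxE enum_rankK_in.
Qed.

Lemma mulmx_subcols n p (J : {set 'I_p}) (A : 'M[R]_(n, p)) (v : 'cV[R]_p) :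
  (forall j, j \notin J -> v j 0 = 0) -> subcols J A *m subvec J v = A *m v.
Proof.
move=> v0; apply/colP => i; rewrite !mxE [RHS](bigID (mem J))/=.
rewrite [X in _ + X]big1 ?addr0; last by move=> j /v0 ->; rewrite mulr0.
by rewrite [RHS]big_enum_val; apply: eq_bigr => k _; rewrite !mxE.
Qed.

(** Cauchy-Schwarz against the all-ones vector. After multiplication by m, the gap is the sum of the
    squares (m |v_i| - a)^2 with a the l1 norm; this needs m > 0, so m = 0 is treated apart. *)
Lemma l1norm_le_l2norm m (v : 'cV[R]_m) : l1norm v ^+ 2 <= m%:R * l2norm v ^+ 2.
Proof.
rewrite l2norm_sqr /dot /l1norm; set a := \sum_i _; set b := \sum_i _.
case: m v @a @b => [|m] v a b; first by rewrite /a big_ord0 mul0r expr0n.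
have m0 : (0 : R) < m.+1%:R by rewrite ltr0n.
rewrite -subr_ge0 -(pmulr_rge0 _ m0).
have -> : m.+1%:R * (m.+1%:R * b - a ^+ 2)
    = \sum_(i < m.+1) (m.+1%:R * `|v i 0| - a) ^+ 2.
  transitivity (m.+1%:R ^+ 2 * b - 2 * m.+1%:R * a * a
      + \sum_(i < m.+1) a ^+ 2).
    by rewrite sumr_const card_ord -mulr_natl; ring.
  rewrite [X in _ - X + _]mulr_sumr mulr_sumr -sumrB -big_split/=.
  apply: eq_bigr => i _; rewrite -expr2 -[v i 0 ^+ 2]real_normK ?num_real//.
  by ring.
by apply: sumr_ge0 => i _; exact: sqr_ge0.
Qed.

End Vectors.

(** * Optimality conditions of the Lasso and of sign-constrained least squares *)

Section Lasso.
Variables (R : realType) (n p : nat) (X : 'M[R]_(n, p)) (y : 'cV[R]_n).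
Variables (lambda : R) (bhat : 'cV[R]_p).
Hypotheses (n_gt0 : (0 < n)%N) (lambda_gt0 : 0 < lambda).
Hypothesis bhatP : lasso_solution X y lambda bhat.

Let n0 : (0 : R) < n%:R. Proof. by rewrite ltr0n. Qed.

Local Notation rho := (rho_hat X y lambda bhat).
Local Notation E := (equicorrelation X y lambda bhat).

(** Compare [bhat] with the point bhat + t (b - bhat). Convexity bounds the l1 norm there by the
    chord, the quadratic part contributes a linear term in t plus O(t^2), and t tends to 0. *)
Lemma lasso_variational (b : 'cV[R]_p) :
  dot (y - X *m bhat) (X *m (b - bhat)) <=
  lambda * n%:R * (l1norm b - l1norm bhat).
Proof.
rewrite -subr_le0; set r := y - _; set h := b - bhat.
apply: (@le0_of_le_mul _ _ (dot (X *m h) (X *m h) / 2)) => t t0 t1.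
have := bhatP (bhat + t *: h).
rewrite /lasso_objective !l2norm_sqr mulmxDr -scalemxAr opprD addrA -/r dot_subZ.
have hb : l1norm (bhat + t *: h) <= (1 - t) * l1norm bhat + t * l1norm b.
  have -> : bhat + t *: h = (1 - t) *: bhat + t *: b.
    by rewrite /h scalerBr scalerBl scale1r addrA addrAC.
  rewrite (le_trans (l1normD _ _))// !l1normZ !ger0_norm ?subr_ge0//.
  by rewrite ltW.
set A := dot r r; set B := dot r _; set C := dot (X *m h) _ => H.
have {}H : (2 * n%:R)^-1 * A + lambda * l1norm bhat <=
   (2 * n%:R)^-1 * (A - 2 * t * B + t ^+ 2 * C)
    + lambda * ((1 - t) * l1norm bhat + t * l1norm b).
  by rewrite (le_trans H)// lerD2l ler_wpM2l// ltW.
have n2 : 0 < 2 * n%:R :> R by rewrite mulr_gt0.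
rewrite -(ler_pM2l n2) in H.
have tn : 0 < 2 * t by rewrite mulr_gt0.
rewrite -subr_le0 -(pmulr_rle0 _ tn); move: H; rewrite -subr_le0.
by congr (_ <= _); field; rewrite gt_eqF.
Qed.

Lemma dot_lasso_residual (b : 'cV[R]_p) :
  dot (y - X *m bhat) (X *m b) = lambda * n%:R * dot rho b.
Proof.
by rewrite dot_mulmxr /rho_hat dotZl mulrA mulfV ?mul1r// mulf_neq0 ?gt_eqF.
Qed.

(** This is the subgradient inequality of the l1 norm at [bhat]. The properties of [rho] and [bhat]
    up to [bhat_off_equicorrelation] are drawn from it by choosing test points. *)
Lemma rho_hat_variational (b : 'cV[R]_p) :
  dot rho b - dot rho bhat <= l1norm b - l1norm bhat.
Proof.
rewrite -(@ler_pM2l _ (lambda * n%:R)) ?mulr_gt0// mulrBr -!dot_lasso_residual.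
by rewrite -dotNr -dotDr -(mulmxN X bhat) -mulmxDr mulmxN lasso_variational.
Qed.

Lemma dot_rho_hat_bhat : dot rho bhat = l1norm bhat.
Proof.
(* The test points 0 and 2 bhat give the two opposite inequalities. *)
have := rho_hat_variational 0; have := rho_hat_variational (2 *: bhat).
rewrite -[in X in _ -> X](scale0r bhat) !dotZr !l1normZ normr0 ger0_norm//.
by move=> h1 h2; apply/eqP; rewrite eq_le; apply/andP; split; lra.
Qed.

Lemma dot_rho_hat_le (b : 'cV[R]_p) : dot rho b <= l1norm b.
Proof. by have := rho_hat_variational b; rewrite dot_rho_hat_bhat lerD2r. Qed.

Lemma rho_hat_le1 j : `|rho j 0| <= 1.
Proof.
(* Testing at plus and minus a basis vector isolates one coordinate. *)
have := dot_rho_hat_le (delta_mx j 0); have := dot_rho_hat_le (- delta_mx j 0).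
rewrite -[- delta_mx j 0]scaleN1r dotZr l1normZ normrN1 mul1r.
rewrite dot_delta l1norm_delta.
by rewrite ler_norml => h1 h2; apply/andP; split=> //; lra.
Qed.

(** Each term of the inner product is at most its counterpart in the l1 norm, and the two sums
    agree, so they agree termwise. *)
Lemma rho_hat_mul_bhat j : rho j 0 * bhat j 0 = `|bhat j 0|.
Proof.
have le i : rho i 0 * bhat i 0 <= `|bhat i 0|.
  by rewrite (le_trans (ler_norm _))// normrM ler_piMl// rho_hat_le1.
have := dot_rho_hat_bhat; rewrite /dot /l1norm => /eqP.
rewrite eq_sym -subr_eq0 -sumrB psumr_eq0; last by move=> k _; rewrite subr_ge0.
by move=> /allP/(_ j); rewrite mem_index_enum subr_eq0 => /(_ isT)/eqP ->.
Qed.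

(** Together with [rho_hat_mul_bhat], this makes [bhat] a competitor in the sign-constrained problem
    that defines [bbar]. *)
Lemma bhat_off_equicorrelation j : j \notin E -> bhat j 0 = 0.
Proof.
rewrite inE; apply: contraNeq => b0.
have : `|rho j 0| * `|bhat j 0| = `|bhat j 0|.
  by rewrite -normrM rho_hat_mul_bhat normr_id.
move/(canRL (mulfK _)); rewrite normr_eq0 => /(_ b0) ->.
by rewrite mulfV ?normr_eq0.
Qed.

Variable bbar : 'cV[R]_p.
Hypothesis bbarP : sign_ls_solution X y lambda bhat bbar.

Lemma bbar_off_equicorrelation j : j \notin E -> bbar j 0 = 0.
Proof. by case: bbarP => + _ _ jE => /subvec_eq0; apply; rewrite inE. Qed.

Lemma rho_hat_mul_bbar j : rho j 0 * bbar j 0 = `|bbar j 0|.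
Proof.
have [jE|/bbar_off_equicorrelation ->] := boolP (j \in E); last first.
  by rewrite mulr0 normr0.
case: bbarP => _ /(_ (enum_rank_in jE j)) + _.
rewrite !subvecE enum_rankK_in// => /ger0_norm <-; rewrite normrM.
by move: jE; rewrite inE => /eqP ->; rewrite mul1r.
Qed.

Lemma dot_rho_hat_bbar : dot rho bbar = l1norm bbar.
Proof. by apply: eq_bigr => j _; exact: rho_hat_mul_bbar. Qed.

(** The feasible set is convex and contains both [bbar] and [bhat], so the segment between them can
    be tested. The result is the obtuse-angle condition of a projection onto a convex set. *)
Lemma sign_ls_variational :
  dot (y - X *m bbar) (X *m (bhat - bbar)) <= 0.
Proof.
set r := y - _; set h := bhat - bbar.
apply: (@le0_of_le_mul _ _ (dot (X *m h) (X *m h) / 2)) => t t0 t1.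
have t1' : 0 <= 1 - t by rewrite subr_ge0.
pose b := bbar + t *: h.
have bE j : b j 0 = (1 - t) * bbar j 0 + t * bhat j 0 by rewrite !mxE; ring.
case: bbarP => _ _ /(_ (subvec E b)).
have feas : sign_feasible (subvec E rho) (subvec E b).
  move=> k; rewrite !subvecE bE mulrDr !(mulrCA (rho _ 0)).
  rewrite rho_hat_mul_bbar rho_hat_mul_bhat.
  by rewrite addr_ge0// mulr_ge0// ltW.
move=> /(_ feas); rewrite /ls_objective.
(* Both vectors vanish off [E], so the restricted design can be replaced by the full one. *)
rewrite !mulmx_subcols; last 2 first.
- move=> j jE; rewrite bE bhat_off_equicorrelation//.
  by rewrite bbar_off_equicorrelation// !mulr0 addr0.
- exact: bbar_off_equicorrelation.
rewrite ler_pM2l ?invr_gt0 ?mulr_gt0// !l2norm_sqr mulmxDr -scalemxAr.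
rewrite opprD addrA -/r dot_subZ.
set A := dot r r; set B := dot r _; set C := dot (X *m h) _ => H.
have tn : 0 < 2 * t by rewrite mulr_gt0.
rewrite -subr_le0 -(pmulr_rle0 _ tn); move: H; rewrite -subr_le0.
by congr (_ <= _); field.
Qed.

End Lasso.

(** * The restricted eigenvalue condition in terms of the l1 norm *)

Section RestrictedEigenvalue.
Variables (R : realType) (n p : nat) (X : 'M[R]_(n, p)).
Hypothesis n_gt0 : (0 < n)%N.

(** The restricted eigenvalue bound combined with Cauchy-Schwarz on the at most [s] coordinates of
    [J]. The condition is silent when [D] vanishes on [J], but then the left-hand side is 0. *)
Lemma RE_constant_l1norm (c kappa : R) (s : nat) (J : {set 'I_p})
    (D : 'cV[R]_p) :
  RE_constant X c s kappa -> (#|J| <= s)%N ->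
  l1norm (subvec (~: J)%SET D) <= c * l1norm (subvec J D) ->
  n%:R * kappa ^+ 2 * l1norm (subvec J D) ^+ 2 <= s%:R * l2norm (X *m D) ^+ 2.
Proof.
move=> [k0 kP] Js cone; have [->|D0] := eqVneq (subvec J D) 0.
  rewrite -(scale0r 0) l1normZ normr0 mul0r expr0n mulr0.
  by rewrite mulr_ge0 ?sqr_ge0.
have n0 : (0 : R) < n%:R by rewrite ltr0n.
have D2 : 0 < l2norm (subvec J D) ^+ 2.
  rewrite lt_neqAle sqr_ge0 andbT eq_sym; apply: contra_neq D0 => D2.
  apply/colP => i; rewrite [RHS]mxE; apply/eqP; move: D2.
  rewrite l2norm_sqr /dot => /eqP.
  rewrite psumr_eq0; last by move=> k _; rewrite -expr2 sqr_ge0.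
  move=> /allP/(_ i); rewrite mem_index_enum mulf_eq0 orbb => /(_ isT).
  exact.
have := kP J D Js D0 cone; rewrite (ler_pdivlMr _ _ (mulr_gt0 n0 D2)) => h.
apply: (@le_trans _ _ (n%:R * kappa ^+ 2 * (s%:R * l2norm (subvec J D) ^+ 2))).
  apply: ler_wpM2l; first by rewrite mulr_ge0 ?sqr_ge0.
  by rewrite (le_trans (l1norm_le_l2norm _))// ler_wpM2r ?sqr_ge0// ler_nat.
by have := ler_wpM2l (ler0n R s) h; congr (_ <= _); ring.
Qed.

(* No cone condition is assumed: outside the cone the left-hand side is
   nonpositive. *)
Lemma RE_constant_cone_bound (c kappa lambda : R) (s : nat) (J : {set 'I_p})
    (D : 'cV[R]_p) :
  RE_constant X c s kappa -> 0 < c -> 0 < lambda -> (0 < s)%N -> (#|J| <= s)%N ->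
  forall a, 0 < a ->
  2 * lambda * n%:R * a *
     (l1norm (subvec J D) - c^-1 * l1norm (subvec (~: J)%SET D)) <=
  l2norm (X *m D) ^+ 2 + n%:R * (lambda ^+ 2 * a ^+ 2 * s%:R / kappa ^+ 2).
Proof.
move=> kP c0 l0 s0 Js a a0.
have n0 : (0 : R) < n%:R by rewrite ltr0n.
have s0' : (0 : R) < s%:R by rewrite ltr0n.
have k0 := kP.1.
have L0 : 0 < 2 * lambda * n%:R * a by rewrite !mulr_gt0.
set q := l1norm (subvec J D); set q' := l1norm _.
have rhs0 : 0 <= n%:R * (lambda ^+ 2 * a ^+ 2 * s%:R / kappa ^+ 2).
  by rewrite !mulr_ge0 ?invr_ge0 ?sqr_ge0// ltW.
have [cone|ncone] := leP q' (c * q); last first.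
  apply: (@le_trans _ _ 0); last by rewrite addr_ge0 ?sqr_ge0.
  apply: mulr_ge0_le0 (ltW L0) _.
  by rewrite subr_le0 ler_pdivlMl// ltW.
have h := RE_constant_l1norm kP Js cone.
have q'0 : 0 <= c^-1 * q' by rewrite mulr_ge0 ?invr_ge0 ?l1norm_ge0// ltW.
apply: (@le_trans _ _ (2 * lambda * n%:R * a * q)).
  by apply: ler_wpM2l (ltW L0) _ _ _; rewrite gerBl.
apply: (@le_trans _ _ (n%:R * kappa ^+ 2 * q ^+ 2 / s%:R
    + n%:R * (lambda ^+ 2 * a ^+ 2 * s%:R / kappa ^+ 2))); last first.
  by rewrite lerD2r ler_pdivrMr// (mulrC _ s%:R).
(* AM-GM: the difference of the two sides is a nonnegative multiple of a perfect square. *)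
rewrite -subr_ge0.
have -> : n%:R * kappa ^+ 2 * q ^+ 2 / s%:R +
    n%:R * (lambda ^+ 2 * a ^+ 2 * s%:R / kappa ^+ 2) - 2 * lambda * n%:R * a * q
  = n%:R / (s%:R * kappa ^+ 2) * (kappa ^+ 2 * q - lambda * a * s%:R) ^+ 2.
  by field; rewrite !gt_eqF.
by rewrite mulr_ge0 ?sqr_ge0// divr_ge0 ?ltW// mulr_gt0// exprn_gt0.
Qed.

End RestrictedEigenvalue.

Lemma l1norm_setID (R : realType) p (J : {set 'I_p}) (v : 'cV[R]_p) :
  l1norm v = l1norm (subvec J v) + l1norm (subvec (~: J)%SET v).
Proof.
rewrite !l1norm_subvec /l1norm (bigID (mem J))/=; congr (_ + _).
by apply: eq_bigl => j; rewrite inE.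
Qed.

(** On the support this is the triangle inequality; off it [beta] is 0, so the entries of [b] and of
    [beta - b] have equal absolute values. *)
Lemma l1norm_supp_sub (R : realType) p (beta b : 'cV[R]_p) :
  l1norm beta - l1norm b <=
  l1norm (subvec (supp beta) (beta - b))
  - l1norm (subvec (~: supp beta)%SET (beta - b)).
Proof.
rewrite (l1norm_setID (supp beta) beta) (l1norm_setID (supp beta) b).
have -> : l1norm (subvec (~: supp beta)%SET beta) = 0.
  rewrite l1norm_subvec big1// => j; rewrite !inE negbK => /eqP ->.
  by rewrite normr0.
have -> : l1norm (subvec (~: supp beta)%SET (beta - b))
    = l1norm (subvec (~: supp beta)%SET b).
  rewrite !l1norm_subvec; apply: eq_bigr => j; rewrite !inE negbK => /eqP bj.
  by rewrite !mxE bj add0r normrN.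
rewrite addr0 opprD addrA lerD2r !l1norm_subvec -sumrB; apply: ler_sum => j _.
by rewrite !mxE lerB_dist.
Qed.

(** * The deterministic oracle inequality under a bound on the noise *)

Section Oracle.
Variables (R : realType) (n p s : nat) (X : 'M[R]_(n, p)).
Variables (beta bhat bbar : 'cV[R]_p) (e : 'cV[R]_n) (lambda kappa1 kappa3 : R).
Hypotheses (n_gt0 : (0 < n)%N) (lambda_gt0 : 0 < lambda).
Hypotheses (s_gt0 : (0 < s)%N) (supp_s : #|supp beta| = s).
Hypothesis bhatP : lasso_solution X (X *m beta + e) lambda bhat.
Hypothesis bbarP : sign_ls_solution X (X *m beta + e) lambda bhat bbar.
Hypothesis noise : forall j, `|(X^T *m e) j 0| <= lambda * n%:R / 4.
Hypotheses (kappa1P : RE_constant X 1 s kappa1)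
  (kappa3P : RE_constant X 3 s kappa3).

Let u := X *m (beta - bbar).
Let v := X *m (beta - bhat).

Lemma prediction_error_sum :
  l2norm u ^+ 2 + l2norm v ^+ 2 <=
  lambda * n%:R * ((l1norm beta - l1norm bbar) + (l1norm beta - l1norm bhat))
  + lambda * n%:R / 2 * l1norm (beta - bbar).
Proof.
have ln0 : 0 < lambda * n%:R by rewrite mulr_gt0 ?ltr0n.
have rhat : X *m beta + e - X *m bhat = v + e by rewrite /v mulmxBr addrAC.
have rbar : X *m beta + e - X *m bbar = u + e by rewrite /u mulmxBr addrAC.
(* Adding the two variational inequalities, each tested at the other solution, cancels the noise. *)
have h1 : dot (v - u) (v - u) <= lambda * n%:R * (l1norm bbar - l1norm bhat).
  have := lasso_variational n_gt0 lambda_gt0 bhatP bbar.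
  have := sign_ls_variational n_gt0 lambda_gt0 bhatP bbarP.
  have -> : X *m (bhat - bbar) = u - v.
    by rewrite /u /v -mulmxBr; congr (_ *m _); apply/colP => i; rewrite !mxE; ring.
  have -> : X *m (bbar - bhat) = v - u.
    by rewrite /u /v -mulmxBr; congr (_ *m _); apply/colP => i; rewrite !mxE; ring.
  by rewrite rhat rbar !dotE (dotC v u); lra.
(* The Lasso residual is v + e. Its inner product with u is lambda n times rho . (beta - bbar),
   where rho . beta <= |beta|_1 and rho . bbar = |bbar|_1; only the term - e . u is left to the
   noise bound. *)
have h2 : dot v u <= lambda * n%:R * (l1norm beta - l1norm bbar)
    + lambda * n%:R / 4 * l1norm (beta - bbar).
  have := @dot_lasso_residual _ _ _ X (X *m beta + e) _ bhat n_gt0 lambda_gt0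
    (beta - bbar).
  have := dot_rho_hat_le n_gt0 lambda_gt0 bhatP beta.
  rewrite -/u rhat dotDl dotDr dotNr (dot_rho_hat_bbar bbarP).
  rewrite -(ler_pM2l ln0).
  have : dot e (- u) <= lambda * n%:R / 4 * l1norm (beta - bbar).
    have -> : - u = X *m (- (beta - bbar)) by rewrite mulmxN.
    rewrite dot_mulmxr -[X in l1norm X]opprK -[- - _]scaleN1r l1normZ.
    rewrite normrN1 mul1r.
    exact: dot_le_l1norm.
  by rewrite dotNr; nra.
by rewrite !l2norm_sqr; move: h1 h2; rewrite !dotE (dotC u v); nra.
Qed.

Lemma oracle_inequality :
  n%:R^-1 * l2norm u ^+ 2 + n%:R^-1 * l2norm v ^+ 2
  <= lambda ^+ 2 * s%:R / kappa1 ^+ 2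
     + 9 * lambda ^+ 2 * s%:R / (4 * kappa3 ^+ 2).
Proof.
have n0 : (0 : R) < n%:R by rewrite ltr0n.
have ln0 : 0 < lambda * n%:R by rewrite mulr_gt0.
have := RE_constant_cone_bound n_gt0 (beta - bhat) kappa1P ltr01
  lambda_gt0 s_gt0 (eq_leq supp_s) ltr01.
(* With r and r' the l1 norms of beta - bbar on and off the support, the noise adds (r + r')/2 to r
   - r', which makes (3/2)(r - r'/3): slope 3/2 and cone constant 3. *)
have c32 : (0 : R) < 3 / 2 by rewrite divr_gt0.
have := RE_constant_cone_bound n_gt0 (beta - bbar) kappa3P
  (ltr0n _ 3) lambda_gt0 s_gt0 (eq_leq supp_s) c32.
have := prediction_error_sum.
have := ler_wpM2l (ltW ln0) (l1norm_supp_sub beta bbar).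
have := ler_wpM2l (ltW ln0) (l1norm_supp_sub beta bhat).
rewrite (l1norm_setID (supp beta) (beta - bbar)) -/u -/v.
rewrite -mulrDr ler_pdivrMl// invfM invr1.
set U := l2norm u ^+ 2; set V := l2norm v ^+ 2.
set q := l1norm (subvec (supp beta) (beta - bhat)); set q' := l1norm _.
set r := l1norm _; set r' := l1norm _.
set b0 := l1norm _; set b1 := l1norm _; set b2 := l1norm _.
set i1 := (kappa1 ^+ 2)^-1; set i3 := (kappa3 ^+ 2)^-1.
by lra.
Qed.

End Oracle.

(** * Affine images, convolution and tails of the normal law on the line *)

Section Normal.
Variable R : realType.
Local Open Scope ereal_scope.
Local Notation mu := (@lebesgue_measure R).

(** The right-hand side is a measure in [A] that gives half-open intervals their length, and
    Lebesgue measure is the only such one. Negative slopes are then reached by reflection. *)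
Lemma lebesgue_measure_affine_gt0 (a b : R) (A : set R) : (0 < a)%R ->
  measurable A ->
  mu A = a%:E * mu ((fun x => a * x + b)%R @^-1` A).
Proof.
move=> a0 mA.
have mf : @measurable_fun _ _ (measurableTypeR R) (measurableTypeR R) setT
    (fun x => a * x + b)%R.
  by apply: measurable_funD => //; exact: measurable_funM.
pose f := @mfun_Sub _ _ (measurableTypeR R) (measurableTypeR R) _ (mem_set mf).
have a0' : (0 <= a)%R by exact: ltW.
apply: (@lebesgue_measure_unique R (mscale (NngNum a0') (pushforward mu f))) => //.
move=> _ [[p q]] _ <-.
change (mu `]p, q]%classic =
  a%:E * mu ((fun x => a * x + b)%R @^-1` `]p, q]%classic)).
have -> : (fun x => a * x + b)%R @^-1` `]p, q]%classic =
    `]((p - b) / a)%R, ((q - b) / a)%R]%classic.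
  by apply/seteqP; split=> x /=;
    rewrite !in_itv/= ler_pdivlMr// ltr_pdivrMr// lerBrDr ltrBlDr mulrC.
rewrite !lebesgue_measure_itv/= !lte_fin ltr_pM2r ?invr_gt0// ltrD2r.
case: ifP => _; rewrite ?mule0// -!EFinB -EFinM; congr EFin; field.
by rewrite gt_eqF.
Qed.

Lemma lebesgue_measure_affine (a b : R) (A : set R) : a != 0%R ->
  measurable A ->
  mu A = `|a|%:E * mu ((fun x => a * x + b)%R @^-1` A).
Proof.
move=> a0 mA; have na0 : (0 < `|a|)%R by rewrite normr_gt0.
have := lebesgue_measure_affine_gt0 b na0 mA.
move: na0; have [a_ge0 _ -> //|a_lt0 na0 ->] := ger0P a.
congr (_ * _).
have mB : measurable ((fun x => - a * x + b)%R @^-1` A : set R).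
  rewrite -[X in measurable X]setTI; apply: (_ : measurable_fun setT _) => //.
  by apply: measurable_funD => //; exact: measurable_funM.
rewrite -(lebesgue_measureN mB) /pushforward.
by congr (mu _); apply/seteqP; split=> x /=; rewrite mulrNN.
Qed.

(** Change of variables: the Jacobian |a| cancels against the peak of the density. The scale
    parameter is allowed to be negative, as products such as [c i * sigma] will be. *)
Lemma normal_prob_affine (m s a b : R) (A : set R) : a != 0%R -> s != 0%R ->
  measurable A ->
  normal_prob m s ((fun x => a * x + b)%R @^-1` A) =
  normal_prob (a * m + b)%R (a * s)%R A.
Proof.
move=> a0 s0 mA.
have as0 : (a * s != 0)%R by rewrite mulf_neq0.
have na0 : (0 <= `|a|)%R by [].
have mf : @measurable_fun _ _ (measurableTypeR R) (measurableTypeR R) setT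
    (fun x => a * x + b)%R.
  by apply: measurable_funD => //; exact: measurable_funM.
have mphi : measurable_fun A (EFin \o normal_pdf (a * m + b) (a * s)).
  by apply/measurable_funTS/measurable_EFinP; exact: measurable_normal_pdf.
pose f := @mfun_Sub _ _ (measurableTypeR R) (measurableTypeR R) _ (mem_set mf).
rewrite /normal_prob [RHS](_ : _ =
  \int[mscale (NngNum na0) (pushforward mu f)]_(y in A)
    (normal_pdf (a * m + b) (a * s) y)%:E); last first.
  by apply: eq_measure_integral => B mB _; exact: lebesgue_measure_affine.
rewrite ge0_integral_mscale//; last first.
  by move=> y _; rewrite lee_fin normal_pdf_ge0.
rewrite ge0_integral_pushforward//; last first.
  by move=> y _; rewrite lee_fin normal_pdf_ge0.
rewrite -ge0_integralZl//; last 3 first.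
- by rewrite -[X in measurable X]setTI; exact: (mf).
- apply: measurableT_comp; last exact: measurable_funTS (mf).
  by apply/measurable_EFinP; exact: measurable_normal_pdf.
- by move=> x _; rewrite lee_fin normal_pdf_ge0.
apply: eq_integral => x _ /=.
rewrite -EFinM !normal_pdfE//; congr EFin.
rewrite /normal_peak /normal_fun mulrA; congr (_ * expR _)%R.
  have -> : ((a * s) ^+ 2 * pi *+ 2 = a ^+ 2 * (s ^+ 2 * pi *+ 2))%R by ring.
  rewrite [in RHS]sqrtrM ?sqr_ge0// sqrtr_sqr invfM mulrA.
  by rewrite mulfV ?mul1r// normr_eq0.
by field; rewrite s0.
Qed.

(** The Radon-Nikodym derivative with respect to Lebesgue measure equals the density almost
    everywhere, since both have the same integral over every measurable set. *)
Lemma integral_normal_prob (m s : R) (f : R -> \bar R) :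
  (normal_prob m s).-integrable [set: R] f ->
  \int[normal_prob m s]_x f x = \int[mu]_x (f x * (normal_pdf m s x)%:E).
Proof.
move=> intf.
have dom := normal_prob_dominates m s.
have mf : measurable_fun [set: R] f := measurable_int _ intf.
have mpdf : measurable_fun [set: R] (EFin \o normal_pdf m s).
  by apply/measurable_EFinP; exact: measurable_normal_pdf.
have mRN : measurable_fun [set: R]
    (Radon_Nikodym (charge_of_finite_measure (normal_prob m s)) mu).
  by apply: (measurable_int mu); exact: Radon_Nikodym_integrable.
rewrite -(Radon_Nikodym_change_of_variables dom)//.
have RNE : ae_eq mu setT
    (Radon_Nikodym (charge_of_finite_measure (normal_prob m s)) mu)
    (EFin \o normal_pdf m s).
  apply: integral_ae_eq => //; first exact: Radon_Nikodym_integrable.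
  by move=> B _ mB; rewrite -Radon_Nikodym_integral.
apply: ae_eq_integral => //; try exact: emeasurable_funM.
by apply: filterS RNE => x /= RNE xT; rewrite RNE.
Qed.

(* Completing the square in x. *)
Lemma normal_pdf_convolution (a b x t : R) : a != 0%R -> b != 0%R ->
  let c := Num.sqrt (a ^+ 2 + b ^+ 2) in
  (normal_pdf x b t * normal_pdf 0 a x =
   normal_pdf 0 c t * normal_pdf (t * a ^+ 2 / c ^+ 2) (a * b / c) x)%R.
Proof.
move=> a0 b0 c.
have ab0 : (0 < a ^+ 2 + b ^+ 2)%R.
  by rewrite addr_gt0// exprn_even_gt0.
have c2 : (c ^+ 2 = a ^+ 2 + b ^+ 2)%R by rewrite sqr_sqrtr// ltW.
have c0 : c != 0%R by rewrite gt_eqF// sqrtr_gt0.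
have v k : (0 <= k ^+ 2 * pi *+ 2)%R.
  by rewrite mulrn_wge0// mulr_ge0 ?sqr_ge0 ?pi_ge0.
rewrite !normal_pdfE//; last by rewrite !mulf_neq0// invr_neq0.
rewrite /normal_peak /normal_fun mulrACA [RHS]mulrACA -!expRD.
congr (_ * expR _)%R.
  rewrite -!invfM -!sqrtrM ?v//.
  by congr (Num.sqrt _)^-1%R; field.
rewrite !expr_div_n !exprMn c2; field.
by rewrite a0 b0 gt_eqF.
Qed.

(** Reconciles signed scales with standard deviations written as square roots of sums of squares. *)
Lemma normal_pdf_norm (m s : R) : normal_pdf m `|s| = normal_pdf m s.
Proof.
have [->|s0] := eqVneq s 0%R; first by rewrite normr0.
apply/funext => x.
by rewrite !normal_pdfE ?normr_eq0// /normal_peak /normal_fun real_normK ?num_real.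
Qed.

(** Write the left-hand side as a double integral of densities and exchange the order by Tonelli.
    Completing the square turns the inner integrand into the target density at t times a normal
    density in x, which integrates to 1. *)
Lemma normal_prob_convolution (a b : R) (A : set R) : a != 0%R -> b != 0%R ->
  measurable A ->
  \int[normal_prob 0 a]_x normal_prob 0 b [set z | A (x + z)%R] =
  normal_prob 0 (Num.sqrt (a ^+ 2 + b ^+ 2)) A.
Proof.
move=> a0 b0 mA; set c := Num.sqrt _.
pose h (z : R * R) := (normal_pdf 0 b (z.2 - z.1) * \1_A z.2)%R.
have pdfE x t : (normal_pdf x b t = normal_pdf 0 b (t - x))%R.
  by rewrite !normal_pdfE// /normal_fun subr0.
have mh : measurable_fun setT (EFin \o h).
  apply/measurable_EFinP/measurable_funM.
    apply: measurableT_comp; first exact: measurable_normal_pdf.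
    exact: measurable_funB.
  have m1A : measurable_fun [set: R] (\1_A : R -> R) by exact: measurable_indic.
  exact: (measurableT_comp m1A measurable_snd).
have h0 z : 0 <= (EFin \o h) z by rewrite lee_fin mulr_ge0// normal_pdf_ge0.
have fE x : normal_prob 0 b [set z | A (x + z)%R] = \int[mu]_t (h (x, t))%:E.
  have := normal_prob_affine 0 x (oner_neq0 R) b0 mA.
  rewrite mulr0 add0r mul1r => E.
  transitivity (normal_prob x b A).
    rewrite -E; congr (normal_prob _ _ _).
    by apply/seteqP; split=> z /=; rewrite mul1r addrC.
  rewrite /normal_prob integral_mkcond; apply: eq_integral => t _.
  by rewrite patchE /h /= -pdfE indicE; case: ifP => _; rewrite ?mulr1 ?mulr0.
have mAx x : measurable [set z | A (x + z)%R].
  rewrite -[X in measurable X]setTI.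
  apply: (_ : measurable_fun setT (fun z => x + z)%R) => //.
  exact: measurable_funD.
have mF : measurable_fun [set: R] (fun x => \int[mu]_t (h (x, t))%:E).
  exact: (@measurable_fun_fubini_tonelli_F _ _ _ _ _ mu _ mh h0).
under eq_integral do rewrite fE.
(* Integrability holds because the integrand is a probability, hence at most 1. *)
rewrite integral_normal_prob; last first.
  apply/integrableP; split=> //.
  apply: (@le_lt_trans _ _ (\int[normal_prob 0 a]_x (cst 1 x))).
    apply: ge0_le_integral => //=.
      exact: measurableT_comp.
    move=> x _; rewrite -fE.
    rewrite gee0_abs//; apply: probability_le1; exact: mAx.
  by rewrite integral_cst//= probability_setT mule1 ltry.
pose g (z : R * R) := (h z * normal_pdf 0 a z.1)%R.
have mg : measurable_fun setT (EFin \o g).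
  apply/measurable_EFinP/measurable_funM; first exact/measurable_EFinP.
  by apply: measurableT_comp; first exact: measurable_normal_pdf.
have g0 z : 0 <= (EFin \o g) z.
  by rewrite lee_fin mulr_ge0 ?normal_pdf_ge0//; exact: h0.
transitivity (\int[mu]_x \int[mu]_t (EFin \o g) (x, t)).
  apply: eq_integral => x _; rewrite -ge0_integralZr//.
  - by apply: (measurableT_comp mh); exact: pair1_measurable.
  - by move=> t _; exact: h0.
  - by rewrite lee_fin normal_pdf_ge0.
rewrite (@fubini_tonelli _ _ _ _ _ mu mu _ mg g0) /normal_prob [RHS]integral_mkcond.
apply: eq_integral => t _.
transitivity (\int[mu]_x ((normal_pdf 0 c t * \1_A t)%:E *
    (normal_pdf (t * a ^+ 2 / c ^+ 2) (a * b / c) x)%:E)).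
  apply: eq_integral => x _; rewrite /= /g /h/= -pdfE -EFinM; congr EFin.
  by rewrite mulrAC normal_pdf_convolution// mulrAC.
rewrite ge0_integralZl//.
- rewrite integral_normal_pdf mule1 patchE indicE.
  by case: ifP => _; rewrite ?mulr1 ?mulr0.
- by apply/measurable_EFinP; exact: measurable_normal_pdf.
- by move=> x _; rewrite lee_fin normal_pdf_ge0.
- by rewrite lee_fin mulr_ge0 ?normal_pdf_ge0.
Qed.

(** Where m x <= 0, (x - m)^2 >= x^2 + m^2, so the densities already compare pointwise. *)
Lemma normal_prob_shift_le (m s : R) (A : set R) : s != 0%R -> measurable A ->
  (forall x, A x -> m * x <= 0)%R ->
  normal_prob m s A <= (expR (- (m ^+ 2 / (s ^+ 2 *+ 2))))%:E * normal_prob 0 s A.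
Proof.
move=> s0 mA mA0.
have mpdf k : measurable_fun A (EFin \o normal_pdf k s).
  by apply/measurable_funTS/measurable_EFinP; exact: measurable_normal_pdf.
rewrite /normal_prob -(ge0_integralZl mu mA (mpdf 0%R)); last 2 first.
- by move=> x _; rewrite lee_fin normal_pdf_ge0.
- by rewrite lee_fin expR_ge0.
apply: ge0_le_integral => //.
- by move=> x _; rewrite lee_fin normal_pdf_ge0.
- exact: (mpdf m).
- by apply: emeasurable_funM; [exact: measurable_cst|exact: (mpdf 0%R)].
move=> x /mA0 mx; rewrite -EFinM lee_fin !normal_pdfE// mulrCA.
rewrite ler_wpM2l ?normal_peak_ge0// /normal_fun -expRD ler_expR subr0.
rewrite !mulNr -opprD lerN2 -mulrDl ler_wpM2r ?invr_ge0 ?mulrn_wge0 ?sqr_ge0//.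
by nra.
Qed.

(* Translating each half-line to the origin gains the exponential factor, and the
   two half-lines at the origin have total mass at most 1: hence no factor 2. *)
Lemma normal_prob_tail (s t : R) : s != 0%R -> (0 <= t)%R ->
  normal_prob 0 s [set x | t < `|x|]%R <= (expR (- (t ^+ 2 / (s ^+ 2 *+ 2))))%:E.
Proof.
move=> s0 t0; set e := expR _.
have -> : [set x | t < `|x|]%R = `]t, +oo[ `|` `]-oo, (- t)%R[.
  apply/seteqP; split=> x /=; rewrite !in_itv/= andbT ltr_normr.
    by case/orP => xt; [left|right; rewrite ltrNr].
  by case=> xt; apply/orP; [left|right; rewrite ltrNr].
have shift m B : measurable B -> normal_prob 0 s B =
    normal_prob (- m)%R s [set x | B (x + m)%R].
  move=> mB; have := normal_prob_affine (- m) m (oner_neq0 R) s0 mB.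
  rewrite !mul1r addNr => <-; congr (normal_prob _ _ _).
  by apply/seteqP; split=> z /=; rewrite mul1r.
have pos : normal_prob 0 s `]t, +oo[ <= e%:E * normal_prob 0 s `]0%R, +oo[.
  rewrite (shift t)//.
  rewrite (_ : [set x | _] = `]0%R, +oo[%classic); last first.
    by apply/seteqP; split=> x /=; rewrite !in_itv/= !andbT ltrDr.
  rewrite /e -sqrrN; apply: normal_prob_shift_le => // x/=.
  by rewrite in_itv/= andbT mulNr oppr_le0 => x0; rewrite mulr_ge0// ltW.
have neg : normal_prob 0 s `]-oo, (- t)%R[ <= e%:E * normal_prob 0 s `]-oo, 0%R[.
  rewrite (shift (- t)%R)// opprK.
  rewrite (_ : [set x | _] = `]-oo, 0%R[%classic); last first.
    by apply/seteqP; split=> x /=; rewrite !in_itv/= gtrDr.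
  apply: normal_prob_shift_le => // x/=.
  by rewrite in_itv/= => x0; rewrite mulr_ge0_le0// ltW.
have [mp mn] : measurable (`]0%R, +oo[ : set R) /\ measurable (`]-oo, 0%R[ : set R).
  by [].
apply: (@le_trans _ _ (normal_prob 0 s `]t, +oo[ + normal_prob 0 s `]-oo, (- t)%R[)).
  exact: measureU2.
apply: (le_trans (leeD pos neg)).
rewrite -ge0_muleDr// -measureU//; last first.
  apply/seteqP; split=> x //= [] /=; rewrite !in_itv/= andbT => x0 /(lt_trans x0).
  by rewrite ltxx.
rewrite -[leRHS]mule1 lee_wpmul2l ?lee_fin ?expR_ge0//.
by apply: probability_le1; exact: measurableU.
Qed.

End Normal.

(** * The sum of two independent normal variables *)

Section JointNormal.
Context (R : realType) (d : measure_display) (T : measurableType d).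
Local Open Scope ereal_scope.

(** [Q] is a general measure so that it can be a probability restricted to an event, with [k] the
    mass of that event. Factorization on rectangles identifies the law of (U, V) as a product
    measure, whose sections lead to the convolution. *)
Lemma joint_normal_sum (Q : {measure set T -> \bar R}) (U V : T -> R)
    (a b k : R) (A : set R) :
  measurable_fun setT U -> measurable_fun setT V ->
  a != 0%R -> b != 0%R -> (0 <= k)%R ->
  (forall A1 A2, measurable A1 -> measurable A2 ->
    Q (U @^-1` A1 `&` V @^-1` A2) =
    normal_prob 0 a A1 * (k%:E * normal_prob 0 b A2)) ->
  measurable A ->
  Q [set w | A (U w + V w)%R] =
  k%:E * normal_prob 0 (Num.sqrt (a ^+ 2 + b ^+ 2)) A.
Proof.
move=> mU mV a0 b0 k0 QE mA.
pose Rm := measurableTypeR R.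
pose h (w : T) : Rm * Rm := (U w, V w).
have mh : @measurable_fun _ _ T (Rm * Rm)%type setT h by exact: measurable_fun_pair.
pose m1 : {sigma_finite_measure set Rm -> \bar R} := normal_prob 0 a.
pose m2 : {sigma_finite_measure set Rm -> \bar R} :=
  mscale (NngNum k0) (normal_prob 0 b).
pose pushQ : {measure set (Rm * Rm) -> \bar R} := pushforward Q h.
pose m' := pushQ mh.
have m'E A1 A2 : measurable A1 -> measurable A2 ->
    m' (A1 `*` A2) = m1 A1 * m2 A2.
  by move=> mA1 mA2; exact: QE.
pose S : set (Rm * Rm) := [set z | A (z.1 + z.2)%R].
have mS : measurable S.
  rewrite -[X in measurable X]setTI.
  apply: (_ : measurable_fun setT (fun z : R * R => z.1 + z.2)%R) => //.
  by apply: measurable_funD; [exact: measurable_fst|exact: measurable_snd].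
transitivity (m' S); first by [].
rewrite -(@product_measure_unique _ _ Rm Rm R m1 m2 m' m'E S mS).
rewrite -normal_prob_convolution// /product_measure1.
have xsE x : xsection S x = [set z | A (x + z)%R].
  by apply/seteqP; split=> z; rewrite /xsection/= inE.
rewrite -ge0_integralZl//.
  by apply: eq_integral => x _; rewrite /= xsE.
under eq_fun do rewrite -xsE.
exact: (measurable_fun_xsection (normal_prob 0 b)).
Qed.
End JointNormal.

(** * Linear combinations of independent centred normal variables *)

Section GaussianSum.
Context (R : realType) (d : measure_display) (T : measurableType d).
Context (P : probability T R) (n : nat) (Z : 'I_n -> {RV P >-> R}).
Context (sigma : R) (c : 'I_n -> R).
Hypothesis sigma_gt0 : (0 < sigma)%R.
Hypothesis ZP : gaussian_noise sigma Z.
Local Open Scope ereal_scope.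

Let cap (J : {set 'I_n}) (B : 'I_n -> set R) : set T :=
  \bigcap_(i in [set` J]) (Z i @^-1` B i).

Let sum (l : seq 'I_n) (w : T) : R := (\sum_(i <- l) c i * Z i w)%R.

Let sd (l : seq 'I_n) : R := Num.sqrt (\sum_(i <- l) (c i * sigma) ^+ 2).

Let measurable_preimage i (A : set R) : measurable A -> measurable (Z i @^-1` A).
Proof. by move=> mA; exact: measurable_funPTI. Qed.

Let measurable_cap J B : (forall i, measurable (B i)) -> measurable (cap J B).
Proof.
move=> mB; apply: fin_bigcap_measurable; first exact: finite_finset.
by move=> i _; exact: measurable_preimage.
Qed.

Let measurable_sum l : measurable_fun setT (sum l).
Proof.
by apply: measurable_sum => i; apply: measurable_funM => //; exact: measurable_funP.
Qed.

Let sd_gt0 i l : all (fun i => c i != 0)%R (i :: l) -> (0 < sd (i :: l))%R.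
Proof.
move=> /= /andP[ci _]; rewrite sqrtr_gt0 big_cons ltr_pwDl//.
  by rewrite exprn_even_gt0// mulf_neq0// gt_eqF.
by rewrite sumr_ge0// => j _; rewrite sqr_ge0.
Qed.

(** Absorbs an event on one more coordinate into the family, which is the form that independence and
    the induction hypothesis accept. *)
Let cap_setU1 (i : 'I_n) (J : {set 'I_n}) (A : set R) (B : 'I_n -> set R) :
  i \notin J ->
  Z i @^-1` A `&` cap J B = cap (i |: J)%SET (fun k => if k == i then A else B k).
Proof.
move=> iJ; apply/seteqP; split=> w /=.
  move=> [Aw Bw] k; rewrite /= in_setU1; case: eqP => [-> _ //|_ /= kJ].
  exact: Bw.
move=> h; split; first by have := h i; rewrite /= eqxx; apply; rewrite setU11.
move=> k /= kJ; have := h k; rewrite /= in_setU1 kJ orbT => /(_ isT).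
by case: eqP => // ki; move: iJ; rewrite -ki kJ.
Qed.

Let prod_setU1 (i : 'I_n) (J : {set 'I_n}) (A : set R) (B : 'I_n -> set R) :
  i \notin J ->
  \prod_(k in (i |: J)%SET) P (Z k @^-1` (if k == i then A else B k)) =
  P (Z i @^-1` A) * \prod_(k in J) P (Z k @^-1` B k).
Proof.
move=> iJ; rewrite big_setU1//= eqxx; congr (_ * _).
apply: eq_bigr => k kJ; case: eqP => // ki.
by move: iJ; rewrite -ki kJ.
Qed.

Let measurable_scale i (A : set R) :
  measurable A -> measurable [set z | A (c i * z)%R].
Proof.
move=> mA; rewrite -[X in measurable X]setTI.
apply: (_ : measurable_fun setT (fun z => c i * z)%R) => //.
exact: measurable_funM.
Qed.

Let prob_preimage_scale i (A : set R) : c i != 0%R -> measurable A ->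
  P (Z i @^-1` [set z | A (c i * z)%R]) = normal_prob 0 (c i * sigma) A.
Proof.
move=> ci mA.
have := ZP.2 i _ (measurable_scale i mA); rewrite /distribution /pushforward => ->.
have s0 : sigma != 0%R by rewrite gt_eqF.
have := normal_prob_affine 0 0 ci s0 mA; rewrite mulr0 addr0 => <-.
by congr (normal_prob _ _ _); apply/seteqP; split=> z /=; rewrite addr0.
Qed.

(* The coordinates outside i :: l are carried along so that the next summand is
   independent of the sum in the induction step. *)
Lemma gaussian_sum_joint (l : seq 'I_n) (i : 'I_n) (J : {set 'I_n}) (A : set R)
    (B : 'I_n -> set R) :
  uniq (i :: l) -> all (fun i => c i != 0)%R (i :: l) ->
  (forall k, k \in i :: l -> k \notin J) ->
  measurable A -> (forall k, measurable (B k)) ->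
  P (sum (i :: l) @^-1` A `&` cap J B) =
  normal_prob 0 (sd (i :: l)) A * \prod_(k in J) P (Z k @^-1` B k).
Proof.
(* The base case is a single summand: an empty sum would have standard deviation 0. *)
elim: l i J A B => [|i l IH] j J A B.
  move=> _ /= /andP[cj _] jJ mA mB.
  have {}jJ : j \notin J by apply: jJ; rewrite mem_head.
  have -> : sum [:: j] @^-1` A = Z j @^-1` [set z | A (c j * z)%R].
    by apply/seteqP; split=> w; rewrite /sum /= big_seq1.
  rewrite cap_setU1// ZP.1; last first.
    by move=> k; case: eqP => // _; exact: measurable_scale.
  rewrite (prod_setU1 _ _ jJ) (prob_preimage_scale cj mA) /sd big_seq1 sqrtr_sqr.
  by rewrite /normal_prob normal_pdf_norm.
move=> /= /andP[jl ul] /andP[cj cl] lJ mA mB.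
have jJ : j \notin J by apply: lJ; rewrite mem_head.
set p := \prod_(k in J) _.
have p0 : 0 <= p by apply: prode_ge0.
have pfin : p \is a fin_num.
  by apply: prode_fin_num => k _; apply: fin_num_measure; exact: measurable_preimage.
have fp0 : (0 <= fine p)%R by rewrite fine_ge0.
have mF : measurable (cap J B) by exact: measurable_cap.
have sd0 : sd (i :: l) != 0%R by rewrite gt_eqF// sd_gt0.
have cs0 : (c j * sigma != 0)%R by rewrite mulf_neq0// gt_eqF.
have mjZ : measurable_fun setT (fun w => c j * Z j w)%R.
  by apply: measurable_funM => //; exact: measurable_funP.
(* Under [P] restricted to [cap J B], the new summand and the old sum factorize: the event on [Z j]
   moves into the family, and the induction hypothesis applies with [j |: J]. *)
have QE A1 A2 : measurable A1 -> measurable A2 ->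
    mrestr P mF ((fun w => c j * Z j w)%R @^-1` A1 `&` sum (i :: l) @^-1` A2) =
    normal_prob 0 (c j * sigma) A1 *
    ((fine p)%:E * normal_prob 0 (sd (i :: l)) A2).
  move=> mA1 mA2; transitivity (P (sum (i :: l) @^-1` A2 `&`
      (Z j @^-1` [set z | A1 (c j * z)%R] `&` cap J B))).
    by rewrite /mrestr setIA [_ `&` (sum _ @^-1` _)]setIC.
  rewrite cap_setU1// IH//.
  - rewrite (prod_setU1 _ _ jJ) (prob_preimage_scale cj mA1) fineK// -/p.
    rewrite muleCA.
    by rewrite [_ A2 * p]muleC.
  - move=> k kl; rewrite in_setU1 negb_or lJ ?andbT; last by rewrite inE kl orbT.
    by apply: contraNneq jl => <-.
  - by move=> k; case: eqP => // _; exact: measurable_scale.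
have sdE : sd [:: j, i & l] = Num.sqrt ((c j * sigma) ^+ 2 + sd (i :: l) ^+ 2).
  rewrite [sd (i :: l)]/sd sqr_sqrtr /sd ?big_cons//.
  by rewrite addr_ge0 ?sqr_ge0// sumr_ge0// => k _; rewrite sqr_ge0.
have sumE w : sum [:: j, i & l] w = (c j * Z j w + sum (i :: l) w)%R.
  by rewrite /sum big_cons.
have := joint_normal_sum mjZ (measurable_sum (i :: l)) cs0 sd0 fp0 QE mA.
rewrite fineK// muleC sdE => <-; rewrite /mrestr; congr (P (_ `&` _)).
by apply/seteqP; split=> w; rewrite /preimage/= sumE.
Qed.

Lemma gaussian_sum_tail (t : R) :
  (0 < \sum_i c i ^+ 2)%R -> (0 <= t)%R ->
  P [set w | t < `|\sum_i c i * Z i w|]%R <=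
  (expR (- (t ^+ 2 / (2 * sigma ^+ 2 * \sum_i c i ^+ 2))))%:E.
Proof.
move=> c2 t0.
(* normal_prob 0 0 is not a Dirac mass but a junk value, so the null coefficients
   are removed first. *)
pose l := [seq i <- index_enum 'I_n | c i != 0%R].
have sumE (F : 'I_n -> R) : (forall i, c i = 0 -> F i = 0)%R ->
    (\sum_i F i = \sum_(i <- l) F i)%R.
  move=> F0; rewrite /l big_filter [LHS](bigID (fun i => c i != 0%R))/=.
  by rewrite [X in (_ + X)%R]big1 ?addr0// => i; rewrite negbK => /eqP/F0.
have ul : uniq l by rewrite filter_uniq// index_enum_uniq.
have cl : all (fun i => c i != 0)%R l by rewrite filter_all.
have sdE : (sd l ^+ 2 = sigma ^+ 2 * \sum_i c i ^+ 2)%R.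
  rewrite sqr_sqrtr; last by rewrite sumr_ge0// => k _; rewrite sqr_ge0.
  rewrite mulr_sumr sumE => [|i ->]; last by rewrite expr0n mulr0.
  by apply: eq_bigr => i _; rewrite exprMn mulrC.
have cZE w : (\sum_i c i * Z i w = sum l w)%R.
  by rewrite sumE// => i ->; rewrite mul0r.
have sd2 : (0 < sd l ^+ 2)%R by rewrite sdE mulr_gt0// exprn_gt0.
(* Intersecting with the trivial event indexed by the empty set gives the shape of
   [gaussian_sum_joint]. *)
have -> : [set w | t < `|\sum_i c i * Z i w|]%R =
    sum l @^-1` [set x | t < `|x|]%R `&` cap finset.set0 (fun=> setT).
  apply/seteqP; split=> w /=; rewrite cZE; last by case.
  by move=> tw; split=> // k /=; rewrite inE.
have sd0 : sd l != 0%R by move: sd2; apply: contraTneq => ->; rewrite expr0n ltxx.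
have mt : measurable [set x : R | t < `|x|]%R.
  rewrite -[X in measurable X]setTI.
  apply: (_ : measurable_fun setT (fun x : R => t < `|x|)%R) => //.
  by apply: measurable_fun_ltr => //; exact: measurableT_comp.
have -> : (2 * sigma ^+ 2 * \sum_i c i ^+ 2 = sd l ^+ 2 *+ 2)%R.
  by rewrite sdE -mulrA mulr_natl.
(* A nonzero standard deviation excludes the empty list. *)
case: l ul cl {sumE sdE cZE sd2} sd0 => [|i l] ul cl sd0.
  by rewrite /sd big_nil sqrtr0 eqxx in sd0.
have l0 k : k \in i :: l -> k \notin finset.set0 by rewrite finset.in_set0.
rewrite (gaussian_sum_joint ul cl l0 mt)//.
by rewrite big_set0 mule1 normal_prob_tail.
Qed.

End GaussianSum.

(** * The union bound over the columns and the conclusion *)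

Theorem corollary3 (R : realType) (d : measure_display) (T : measurableType d)
    (P : probability T R) (n p s : nat) (X : 'M[R]_(n, p))
    (beta : 'cV[R]_p) (sigma delta lambda kappa1 kappa3 : R)
    (eps : 'I_n -> {RV P >-> R})
    (y : T -> 'cV[R]_n) (bhat bbar : T -> 'cV[R]_p)
    (hn : (0 < n)%N)
    (hX : forall j : 'I_p, l2norm (col j X) ^+ 2 = n%:R)
    (hs : #|supp beta| = s) (hs0 : (0 < s)%N)
    (hsigma : 0 < sigma)
    (heps : gaussian_noise sigma eps)
    (hy : forall w : T, y w = X *m beta + random_vector eps w)
    (hRE : RE X 3 s)
    (hkappa3 : RE_constant X 3 s kappa3)
    (hkappa1 : RE_constant X 1 s kappa1)
    (hdelta : 0 < delta < 1)
    (hlambda : lambda = 5 * sigma * Num.sqrt (2 * ln (p%:R / delta) / n%:R))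
    (hbhat : forall w : T, lasso_solution X (y w) lambda (bhat w))
    (hbbar : forall w : T,
       sign_ls_solution X (y w) lambda (bhat w) (bbar w)) :
  with_probability_ge P (1 - delta)
    [set w : T |
      n%:R^-1 * l2norm (X *m (beta - bbar w)) ^+ 2
      + n%:R^-1 * l2norm (X *m (beta - bhat w)) ^+ 2
      <= lambda ^+ 2 * s%:R / kappa1 ^+ 2
         + 9 * lambda ^+ 2 * s%:R / (4 * kappa3 ^+ 2)].
Proof.
have n0 : (0 : R) < n%:R by rewrite ltr0n.
have p0 : (0 : R) < p%:R.
  rewrite ltr0n (leq_trans hs0)// -hs (leq_trans (max_card _))//.
  by rewrite card_ord.
case/andP: hdelta => delta0 delta1.
(* Here p >= 1 because the support is nonempty; the logarithm, and with it [lambda], is therefore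
   positive. *)
have pd1 : 1 < p%:R / delta.
  rewrite ltr_pdivlMr// mul1r (lt_le_trans delta1)//.
  by rewrite ler1n -(ltr0n R).
have ln0 : 0 < ln (p%:R / delta) by rewrite ln_gt0.
have arg0 : 0 < 2 * ln (p%:R / delta) / n%:R by rewrite !mulr_gt0 ?invr_gt0.
have lambda0 : 0 < lambda by rewrite hlambda !mulr_gt0 ?sqrtr_gt0.
(* The 5 cancels the one in [lambda], so that t^2 / (2 sigma^2 n) is exactly log(p / delta) and each
   column fails with probability at most delta / p. *)
pose t := lambda * n%:R / 5.
have t0 : 0 <= t by rewrite !mulr_ge0 ?invr_ge0// ltW.
pose bad j := [set w | t < `|\sum_i X i j * eps i w|].
have mbad j : measurable (bad j).
  have mf : measurable_fun [set: T] (fun w => \sum_i X i j * eps i w).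
    by apply: measurable_sum => i; exact: measurable_funM.
  rewrite -[bad j]setTI.
  apply: (_ : measurable_fun setT
    (fun w => t < `|\sum_i X i j * eps i w|)) => //.
  by apply: measurable_fun_ltr => //; exact: measurableT_comp mf.
have bad_le j : (P (bad j) <= (delta / p%:R)%:E)%E.
  have c2 : \sum_i X i j ^+ 2 = n%:R.
    by rewrite -(hX j) l2norm_sqr; apply: eq_bigr => i _; rewrite !mxE expr2.
  have := @gaussian_sum_tail _ _ _ P _ eps sigma (fun i => X i j) hsigma heps t.
  rewrite c2 => /(_ n0 t0) /le_trans; apply; rewrite lee_fin.
  have -> : t ^+ 2 / (2 * sigma ^+ 2 * n%:R) = ln (p%:R / delta).
    rewrite /t hlambda !exprMn sqr_sqrtr ?ltW//; field.
    by rewrite !gt_eqF.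
  by rewrite -lnV ?posrE ?divr_gt0// invf_div lnK// posrE divr_gt0.
pose B := \big[setU/set0]_j bad j.
have [mB PB] : measurable B /\ (P B <= \sum_(j < p) (delta / p%:R)%:E)%E.
  rewrite /B; elim/big_rec2: _ => [|j x A _ [mA PA]]; first by rewrite measure0.
  split; first exact: measurableU.
  apply: (le_trans (measureU2 P (mbad j) mA)); exact: leeD (bad_le j) PA.
(* The good event depends on the noise alone, so it is measurable however the solutions are
   selected. *)
exists (~` B); split; first exact: measurableC.
- move=> w /= Bw.
  apply: (@oracle_inequality _ _ _ _ _ _ _ _ (random_vector eps w)) => //.
  + by rewrite -hy.
  + by rewrite -hy.
  move=> j; rewrite leNgt; apply/negP => h; apply: Bw.
  rewrite /B -bigcup_seq; exists j; first by rewrite /= mem_index_enum.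
  rewrite /bad/=.
  have <- : (X^T *m random_vector eps w) j 0 = \sum_i X i j * eps i w.
    by rewrite mxE; apply: eq_bigr => i _; rewrite !mxE.
  (* The deterministic part asks only for lambda n / 4, which exceeds the threshold lambda n / 5. *)
  apply: le_lt_trans h; rewrite /t ler_wpM2l ?mulr_ge0 ?ltW//.
  by rewrite ltf_pV2 ?posrE// ltr_nat.
rewrite probability_setC// EFinB leeB//; apply: le_trans PB _.
rewrite sumEFin lee_fin sumr_const card_ord -(mulr_natr (delta / p%:R)).
by rewrite divfK// gt_eqF.
Qed.
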